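(* There exist a dictionary $\mathbf{D}\in\mathbb{R}^{d\times k}$ with nonzero columns, a support $S\subseteq[k]$ such that $\widehat{\mathbf{D}}_S$ has full column rank, and a nested sequence $[k]=T_0\supset T_1\supset\cdots\supset T_L$ of index sets with $S\subseteq T_\ell$ for all $\ell=0,\dots,L$, such that $$\mathrm{ERC}(\widehat{\mathbf{D}};S)\ge 1\qquad\text{and}\qquad \mathrm{ERC}(\widehat{\mathbf{D}};S\,|\,T_L)<1 .$$ Consequently, hierarchical OMP has a strictly larger ERC-certified success region than global OMP on the full dictionary: the set of instances $(\mathbf{D},S,(T_\ell)_{\ell=0}^L)$ (where $\mathbf{D}\in\mathbb{R}^{d\times k}$ is a dictionary with nonzero columns, $S\subseteq[k]$ is a support such that $\widehat{\mathbf{D}}_S$ has full column rank, and $[k]=T_0\supset T_1\supset\cdots\supset T_L$ is a nested sequence of index sets with $S\subseteq T_\ell$ for all $\ell=0,\dots,L$) with $\mathrm{ERC}(\widehat{\mathbf{D}};S)<1$ is a proper subset of the set of such instances with $\mathrm{ERC}(\widehat{\mathbf{D}};S\,|\,T_L)<1$.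
   Context: $[k]=\{1,\dots,k\}$. For $\mathbf{D}=[\mathbf{d}_1,\dots,\mathbf{d}_k]$ with nonzero columns, $\widehat{\mathbf{D}}=[\widehat{\mathbf{d}}_1,\dots,\widehat{\mathbf{d}}_k]$ with $\widehat{\mathbf{d}}_j=\mathbf{d}_j/\|\mathbf{d}_j\|_2$ is the column-normalized dictionary; $\widehat{\mathbf{D}}_S$ is the submatrix of columns indexed by $S$, and $\widehat{\mathbf{D}}_S^\dagger$ its Moore–Penrose pseudoinverse. For $S$ with $\widehat{\mathbf{D}}_S$ of full column rank, and $T\supseteq S$, the exact recovery coefficients are $$\mathrm{ERC}(\widehat{\mathbf{D}};S)=\max_{j\in [k]\setminus S}\|\widehat{\mathbf{D}}_S^\dagger\widehat{\mathbf{d}}_j\|_1,\qquad \mathrm{ERC}(\widehat{\mathbf{D}};S\,|\,T)=\max_{j\in T\setminus S}\|\widehat{\mathbf{D}}_S^\dagger\widehat{\mathbf{d}}_j\|_1,$$ where a maximum over the empty set is $0$. An instance is ERC-certified for global orthogonal matching pursuit (OMP, searching over all of $[k]$) if $\mathrm{ERC}(\widehat{\mathbf{D}};S)<1$, and ERC-certified for hierarchical OMP (whose search is restricted to $T_L$) if $\mathrm{ERC}(\widehat{\mathbf{D}};S\,|\,T_L)<1$. *)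

(* Defs.v *)
From mathcomp Require Import all_boot all_order all_algebra.
From mathcomp Require Import boolp classical_sets reals.

Set Implicit Arguments.
Unset Strict Implicit.
Unset Printing Implicit Defensive.

Import Order.TTheory GRing.Theory Num.Theory.
Local Open Scope classical_set_scope.
Local Open Scope ring_scope.

Section MoorePenrose.
Variable R : realType.

Definition is_mp_inverse m n (A : 'M[R]_(m, n)) (X : 'M[R]_(n, m)) : Prop :=
  [/\ A *m X *m A = A, X *m A *m X = X,
      (A *m X)^T = A *m X & (X *m A)^T = X *m A].

(* MathComp's [pinvmx] is only a one-sided partial inverse, not the
   Moore-Penrose inverse.  The default value [0] below is never used: see
   [mp_inverseP] and [is_mp_inverse_uniq]. *)
Definition mp_inverse m n (A : 'M[R]_(m, n)) : 'M[R]_(n, m) :=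
  xget 0 [set X | is_mp_inverse A X].

Lemma is_mp_inverse_uniq m n (A : 'M[R]_(m, n)) X Y :
  is_mp_inverse A X -> is_mp_inverse A Y -> X = Y.
Proof.
move=> [X1 X2 X3 X4] [Y1 Y2 Y3 Y4].
have eAX : A *m X = A *m Y.
  have h : A *m X = (A *m Y) *m (A *m X) by rewrite mulmxA Y1.
  by rewrite -X3 h trmx_mul X3 Y3 mulmxA X1.
have eXA : X *m A = Y *m A.
  have h : X *m A = (X *m A) *m (Y *m A) by rewrite -mulmxA (mulmxA A) Y1.
  by rewrite -X4 h trmx_mul X4 Y4 -mulmxA (mulmxA A) X1.
by rewrite -X2 eXA -mulmxA eAX mulmxA Y2.
Qed.

Lemma row_free_gram_unit m n (A : 'M[R]_(m, n)) :
  row_free A -> A *m A^T \in unitmx.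
Proof.
move=> fA; rewrite -row_free_unit -kermx_eq0; apply/rowV0P => u /sub_kermxP uA0.
have /eqP : (u *m A) *m (u *m A)^T = 0.
  by rewrite trmx_mul !mulmxA -(mulmxA u) uA0 mul0mx.
move=> /eqP/matrixP/(_ 0 0); rewrite !mxE => /eqP.
rewrite psumr_eq0 => [/allP s0|i _]; last by rewrite [_^T _ _]mxE -expr2 sqr_ge0.
suff uA : u *m A = 0 by apply: (row_free_inj fA); rewrite uA mul0mx.
apply/rowP => j; rewrite [RHS]mxE; apply/eqP; rewrite -sqrf_eq0 expr2.
by have := s0 j (mem_index_enum _); rewrite [_^T _ _]mxE.
Qed.

Lemma mp_inverseP m n (A : 'M[R]_(m, n)) : is_mp_inverse A (mp_inverse A).
Proof.
apply: (@xgetPex _ 0 [set X | is_mp_inverse A X]).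
have [r [B [C [-> fB fC]]]] : exists r (B : 'M[R]_(r, n)) (C : 'M[R]_(m, r)),
    [/\ A = C *m B, row_free B & row_full C].
  exists (\rank A), (row_base A), (col_base A).
  by rewrite mulmx_base row_base_free col_base_full.
have uB : B *m B^T \in unitmx by exact: row_free_gram_unit.
have uC : C^T *m C \in unitmx.
  rewrite -{2}[C]trmxK; apply: row_free_gram_unit.
  by rewrite /row_free mxrank_tr.
set G := invmx (B *m B^T); set H := invmx (C^T *m C).
have sG : G^T = G by rewrite /G trmx_inv trmx_mul trmxK.
have sH : H^T = H by rewrite /H trmx_inv trmx_mul trmxK.
have eAX : C *m B *m (B^T *m G *m H *m C^T) = C *m H *m C^T.
  rewrite !mulmxA -(mulmxA C) -(mulmxA C (B *m B^T)).
  by rewrite mulmxV // mulmx1.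
have eXA : (B^T *m G *m H *m C^T) *m (C *m B) = B^T *m G *m B.
  by rewrite !mulmxA -(mulmxA _ C^T C) -(mulmxA _ H) mulVmx // mulmx1.
exists (B^T *m G *m H *m C^T); split.
- by rewrite eAX !mulmxA -(mulmxA _ C^T C) -(mulmxA _ H) mulVmx // mulmx1.
- rewrite eXA !mulmxA -(mulmxA _ B B^T) -(mulmxA _ (B *m B^T) G).
  by rewrite mulmxV // mulmx1.
- by rewrite eAX !trmx_mul trmxK sH mulmxA.
- by rewrite eXA !trmx_mul trmxK sG mulmxA.
Qed.

End MoorePenrose.

Section ERC.
Variable R : realType.

(* Explicit vector norms: the library norm on matrices is the sup norm. *)
Definition l1norm n (v : 'cV[R]_n) : R := \sum_i `|v i 0|.

Definition l2norm n (v : 'cV[R]_n) : R := Num.sqrt (\sum_i v i 0 ^+ 2).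

Definition nonzero_columns d k (D : 'M[R]_(d, k)) : Prop :=
  forall j, col j D != 0.

Definition normalize_columns d k (D : 'M[R]_(d, k)) : 'M[R]_(d, k) :=
  \matrix_(i, j) (D i j / l2norm (col j D)).

Definition columns d k (S : {set 'I_k}) (D : 'M[R]_(d, k)) : 'M[R]_(d, #|S|) :=
  colsub (@enum_val _ (mem S)) D.

Definition full_column_rank m n (A : 'M[R]_(m, n)) : Prop := \rank A = n.

(* [D] is meant to be a dictionary that is already column-normalized. *)
Definition recovery_norm d k (D : 'M[R]_(d, k)) (S : {set 'I_k}) (j : 'I_k) : R :=
  l1norm (mp_inverse (columns S D) *m col j D).

(* The values are nonnegative, so the initial value [0] only matters for an
   empty index set, where it is the stipulated value. *)
Definition ERC d k (D : 'M[R]_(d, k)) (S : {set 'I_k}) : R :=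
  \big[Num.max/0]_(j in ~: S) recovery_norm D S j.

Definition ERC_in d k (D : 'M[R]_(d, k)) (S T : {set 'I_k}) : R :=
  \big[Num.max/0]_(j in T :\: S) recovery_norm D S j.

Definition nested_from_full k L (T : 'I_L.+1 -> {set 'I_k}) : Prop :=
  T ord0 = [set: 'I_k]%SET /\
  (forall l m : 'I_L.+1, m = l.+1 :> nat -> T m \proper T l).

Definition valid_instance d k L (D : 'M[R]_(d, k)) (S : {set 'I_k})
    (T : 'I_L.+1 -> {set 'I_k}) : Prop :=
  [/\ nonzero_columns D,
      full_column_rank (columns S (normalize_columns D)),
      nested_from_full T
    & forall l, S \subset T l].

End ERC.

(* The dimensions and the depth are part of an instance; its well-formedness
   is imposed separately, by [valid]. *)
Record omp_instance (R : realType) := OmpInstance {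
  ambient_dim : nat;
  num_atoms : nat;
  depth : nat;
  dictionary : 'M[R]_(ambient_dim, num_atoms);
  support : {set 'I_num_atoms};
  levels : 'I_depth.+1 -> {set 'I_num_atoms}
}.

Definition valid (R : realType) (I : omp_instance R) : Prop :=
  valid_instance (dictionary I) (support I) (@levels R I).

Definition global_certified (R : realType) : set (omp_instance R) :=
  [set I | valid I /\
    ERC (normalize_columns (dictionary I)) (support I) < 1].

Definition hierarchical_certified (R : realType) : set (omp_instance R) :=
  [set I | valid I /\
    ERC_in (normalize_columns (dictionary I)) (support I)
      (levels (ord_max : 'I_(depth I).+1)) < 1].

(* Main.v *)
(* A duplicate of an atom of the support forces a recovery coefficient equal
   to 1; restricting the search to [T_1 = S] discards the duplicate.  The
   witness is the dictionary of two equal atoms in dimension one. *)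
Require Import Defs.
From mathcomp Require Import all_boot all_order all_algebra.
From mathcomp Require Import boolp classical_sets reals.
Import Order.TTheory GRing.Theory Num.Theory.
Local Open Scope classical_set_scope.
Local Open Scope ring_scope.

(** Since [T :\: S] lies in [~: S], restricting the search only drops terms from the maximum. *)
Lemma ERC_lt1_ERC_in_lt1 (R : realType) d k (D : 'M[R]_(d, k))
    (S T : {set 'I_k}) : ERC D S < 1 -> ERC_in D S T < 1.
Proof.
move=> /bigmax_ltP[_ ltS]; apply/bigmax_ltP; split=> // j.
by rewrite inE => /andP[jS _]; apply: ltS; rewrite inE.
Qed.

Lemma ERC_in_id (R : realType) d k (D : 'M[R]_(d, k)) (S : {set 'I_k}) :
  ERC_in D S S = 0.
Proof. by rewrite /ERC_in finset.setDv big_set0. Qed.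

Lemma l1norm_ge_sum (R : realType) n (v : 'cV[R]_n) :
  \sum_i v i 0 <= l1norm v.
Proof. by apply: ler_sum => i _; apply: ler_norm. Qed.

Lemma normalize_columns_const1 (R : realType) k :
  normalize_columns (const_mx 1 : 'M[R]_(1, k)) = const_mx 1.
Proof.
apply/matrixP => i j; rewrite !mxE /l2norm big_ord1 !mxE.
by rewrite expr1n sqrtr1 divr1.
Qed.

(** For a row [A] of ones, any entry of the Penrose equation [A *m X *m A = A] says that the entries
    of [X] sum to 1, and the l1 norm dominates this sum. *)
Lemma recovery_norm_const1 (R : realType) k (S : {set 'I_k}) (j : 'I_k) :
  (0 < #|S|)%N -> 1 <= recovery_norm (const_mx 1 : 'M[R]_(1, k)) S j.
Proof.
move=> S_gt0; rewrite /recovery_norm.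
have -> : columns S (const_mx 1 : 'M[R]_(1, k)) = const_mx 1.
  by apply/matrixP => a b; rewrite !mxE.
have -> : col j (const_mx 1 : 'M[R]_(1, k)) = 1%:M.
  by apply/matrixP => a b; rewrite !mxE !ord1.
rewrite mulmx1; apply: le_trans (l1norm_ge_sum _ _ _).
have [/matrixP/(_ 0 (Ordinal S_gt0)) + _ _ _] :=
  mp_inverseP (const_mx 1 : 'M[R]_(1, #|S|)).
rewrite mxE big_ord1 !mxE mulr1 => {1}<-.
by apply: ler_sum => i _; rewrite mxE mul1r.
Qed.

Lemma duplicate_atom_instance (R : realType) :
  let D : 'M[R]_(1, 2) := const_mx 1 in
  let S : {set 'I_2} := [set ord0]%SET in
  let T (l : 'I_2) : {set 'I_2} := if l == ord0 then [set: 'I_2]%SET else S in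
  [/\ valid_instance D S T, 1 <= ERC (normalize_columns D) S
    & ERC_in (normalize_columns D) S (T ord_max) < 1].
Proof.
move=> D S T; have S1 : #|S| = 1%N by rewrite cards1.
(* [T ord_max] computes to [S], so the restricted maximum is over the empty set. *)
split; last by rewrite ERC_in_id.
- split.
  + move=> j; apply/eqP => /matrixP/(_ 0 0)/eqP.
    by rewrite !mxE oner_eq0.
  (* The submatrix is a single row, so its rank is 1 as soon as it is nonzero. *)
  + rewrite /full_column_rank normalize_columns_const1 rank_rV.
    case: eqP => [|_]; last by rewrite S1.
    have S_gt0 : (0 < #|S|)%N by rewrite S1.
    move=> /matrixP/(_ 0 (Ordinal S_gt0))/eqP.
    by rewrite !mxE oner_eq0.
  (* The only consecutive levels are 0 and 1; the second atom separates them. *)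
  + split=> // -[[|[|//]] l2] [[|[|//]] m2] //= _.
    by rewrite /T /= properT; apply/eqP => /setP/(_ ord_max); rewrite !inE.
  + by move=> l; rewrite /T; case: ifP.
- rewrite normalize_columns_const1.
  (* [ord_max] is the duplicate atom, outside [S]. *)
  apply: (le_trans (recovery_norm_const1 R 2 S ord_max _)); first by rewrite S1.
  by apply: le_bigmax_cond; rewrite !inE.
Qed.

Theorem proposition4 (R : realType) :
  (exists (d k L : nat) (D : 'M[R]_(d, k)) (S : {set 'I_k})
      (T : 'I_L.+1 -> {set 'I_k}),
    [/\ valid_instance D S T,
        1 <= ERC (normalize_columns D) S
      & ERC_in (normalize_columns D) S (T ord_max) < 1]) /\
  @global_certified R `<` @hierarchical_certified R.
Proof.
have [vI ge1 lt1] := duplicate_atom_instance R.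
split; first by do 6 eexists; split; [exact: vI|exact: ge1|exact: lt1].
split=> [I [vJ ltI]|sub].
  by split=> //; apply: ERC_lt1_ERC_in_lt1.
(* The reverse inclusion would certify the duplicate-atom instance globally, against [ge1]. *)
have [_] := sub (OmpInstance _ _ _) (conj vI lt1).
by rewrite /= ltNge ge1.
Qed.
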